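(* Let $q$ be a prime power. The class $\mathcal{K}(\mathbb{F}_q)=\{M_n(\mathbb{F}_q): n\in\mathbb{N},\ n\ge 1\}$ of full matrix algebras, regarded as metric structures in the language of unital $\mathbb{F}_q$-algebras with a metric, where $M_n(\mathbb{F}_q)$ carries the metric $d(x,y)=\frac{\mathrm{rank}(x-y)}{n}$, is a metric Fraïssé class; that is, it satisfies the Joint Embedding Property, the Near Amalgamation Property and the Weak Polish Property.
   Context: An embedding between metric unital $\mathbb{F}_q$-algebras is a unital, isometric $\mathbb{F}_q$-algebra homomorphism. For maps $f,g:A\to B$ into a metric structure, $d(f,g)=\sup_{x\in A}d(f(x),g(x))$. For a class $\mathcal{K}$ of finitely generated metric structures in a fixed language: Joint Embedding Property (JEP): for any $A,B\in\mathcal{K}$ there is $C\in\mathcal{K}$ such that both $A$ and $B$ embed into $C$. Near Amalgamation Property (NAP): for any $A,B_0,B_1\in\mathcal{K}$, embeddings $\phi_i:A\hookrightarrow B_i$ ($i=0,1$) and $\varepsilon>0$, there are $C\in\mathcal{K}$ and embeddings $\psi_i:B_i\hookrightarrow C$ with $d(\psi_0\circ\phi_0,\psi_1\circ\phi_1)<\varepsilon$. Weak Polish Property (WPP): for each $n\in\mathbb{N}$ let $\mathcal{K}_n$ be the class of structures in $\mathcal{K}$ with a specified generating $n$-tuple (repetitions allowed, so that there are at most $n$ distinct generators). For $\bar a,\bar b\in\mathcal{K}_n$ let $d_n(\bar a,\bar b)=\inf d(\phi(\bar a),\psi(\bar b))$, where the distance between $n$-tuples is the maximum of the coordinatewise distances,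 and the infimum is over all embeddings $\phi:\langle\bar a\rangle\hookrightarrow C$, $\psi:\langle\bar b\rangle\hookrightarrow C$ into a common structure $C\in\mathcal{K}$; given JEP and NAP this is a pseudometric. WPP says that each $d_n$ is separable. $\mathcal{K}$ is a metric Fraïssé class if it satisfies JEP, NAP and WPP. *)

(* Defs.v *)
From HB Require Import structures.
From mathcomp Require Import all_boot all_order all_algebra.
From mathcomp Require Import all_classical all_reals topology ereal.

Set Implicit Arguments.
Unset Strict Implicit.
Unset Printing Implicit Defensive.

Import Order.TTheory GRing.Theory Num.Theory.

Local Open Scope classical_set_scope.
Local Open Scope ring_scope.

(* What it means for a unital F-algebra with a metric to be a metric structure:
   the symbols of the language are interpreted by uniformly continuous
   functions and the metric is complete. *)
HB.mixin Record isMetricStructure (R : realType) (F : fieldType) A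
    & GRing.Algebra F A & Metric R A := {
  madd_unif_continuous : unif_continuous (fun z : A * A => z.1 + z.2) ;
  mmul_unif_continuous : unif_continuous (fun z : A * A => z.1 * z.2) ;
  mscale_unif_continuous :
    forall a : F, unif_continuous (fun x : A => a *: x) ;
  mcomplete : forall G : set_system A,
    ProperFilter G -> cauchy G -> exists x : A, G --> x
}.

#[short(type="metricAlgType")]
HB.structure Definition MetricAlgebra (R : realType) (F : fieldType) :=
  { A of GRing.Algebra F A & Metric R A & isMetricStructure R F A }.

Section metric_fraisse.
Context {R : realType} {F : fieldType}.
Local Notation malg := (metricAlgType R F).

Record embedding (A B : malg) := Embedding {
  embedding_hom :> {lrmorphism A -> B} ;
  embedding_isometric :
    forall x y : A, mdist (embedding_hom x) (embedding_hom y) = mdist x y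
}.

(* A metric is not assumed to be bounded, so that suprema (and infima over
   possibly empty families) are taken in the extended reals. *)
Definition map_dist (A B : malg) (f g : A -> B) : \bar R :=
  ereal_sup (range (fun x : A => (mdist (f x) (g x))%:E)).

(* The base value 0 matters only for n = 0, distances being nonnegative. *)
Definition tuple_dist (n : nat) (A : malg) (a b : n.-tuple A) : R :=
  \big[Num.max/0]_(i < n) mdist (tnth a i) (tnth b i).

(* Substructures of a metric structure are closed, so <a> is the smallest
   closed unital subalgebra that contains the entries of a. *)
Definition generates (n : nat) (A : malg) (a : n.-tuple A) : Prop :=
  forall S : {pred A}, GRing.subalg_closed S -> closed [set` S] ->
    {subset a <= S} -> forall x : A, x \in S.

Definition finitely_generated (A : malg) : Prop :=
  exists (n : nat) (a : n.-tuple A), generates a.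

Section class.
Variable K : malg -> Prop.

Definition JEP : Prop :=
  forall A B : malg, K A -> K B ->
  exists2 C : malg, K C & inhabited (embedding A C) /\ inhabited (embedding B C).

Definition NAP : Prop :=
  forall (A B0 B1 : malg) (phi0 : embedding A B0) (phi1 : embedding A B1)
    (e : R), K A -> K B0 -> K B1 -> 0 < e ->
  exists (C : malg) (psi0 : embedding B0 C) (psi1 : embedding B1 C),
    K C /\ (map_dist (psi0 \o phi0) (psi1 \o phi1) < e%:E)%E.

Record marked (n : nat) := Marked {
  marked_alg : malg ;
  marked_in : K marked_alg ;
  marked_gen : n.-tuple marked_alg ;
  marked_generates : generates marked_gen
}.

Definition marked_dist (n : nat) (a b : marked n) : \bar R :=
  ereal_inf [set r : \bar R | exists (C : malg)
    (phi : embedding (marked_alg a) C) (psi : embedding (marked_alg b) C),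
    K C /\ r = (tuple_dist (map_tuple phi (marked_gen a))
                           (map_tuple psi (marked_gen b)))%:E].

(* The sequence u enumerates a countable dense subset, empty or finite ones
   included. The library's countable cannot be used here: T will be a type of
   structures, which is too large to be the carrier of a set T. *)
Definition separable_dist (T : Type) (d : T -> T -> \bar R) : Prop :=
  exists u : nat -> option T, forall (x : T) (e : R), 0 < e ->
    exists (k : nat) (y : T), u k = Some y /\ (d x y < e%:E)%E.

Definition WPP : Prop := forall n : nat, separable_dist (@marked_dist n).

Definition metric_fraisse_class : Prop :=
  [/\ forall A : malg, K A -> finitely_generated A, JEP, NAP & WPP].

End class.
End metric_fraisse.

(* 'M[F]_n.+1 carries the normalised rank metric with values in R; the
   parameter R only serves to select the type of distances, and the shift
   by 1 encodes that the size of the matrices is positive. *)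
Definition rank_matrix (R : realType) (F : fieldType) (n : nat) : Type :=
  'M[F]_n.+1.

Section rank_metric.
Variables (R : realType) (F : fieldType) (n : nat).
Local Notation M := (rank_matrix R F n).

HB.instance Definition _ := GRing.Algebra.copy M 'M[F]_n.+1.

Definition rank_dist (x y : M) : R := (\rank (x - y : 'M[F]_n.+1))%:R / n.+1%:R.

Lemma rank_distxx x : rank_dist x x = 0.
Proof. by rewrite /rank_dist subrr mxrank0 mul0r. Qed.

Lemma rank_dist_ge x y : x != y -> n.+1%:R^-1 <= rank_dist x y.
Proof.
move=> xy; rewrite /rank_dist ler_peMl ?invr_ge0 ?ler0n// ler1n.
by rewrite lt0n mxrank_eq0 subr_eq0.
Qed.

Lemma rank_dist_positivity x y : rank_dist x y = 0 -> x = y.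
Proof.
move=> xy0; apply/eqP; apply: contraT => /rank_dist_ge.
by rewrite xy0 leNgt invr_gt0 ltr0n.
Qed.

Lemma rank_dist_sym x y : rank_dist x y = rank_dist y x.
Proof. by rewrite /rank_dist -opprB mxrank_opp. Qed.

Lemma rank_dist_triangle y x z :
  rank_dist x z <= rank_dist x y + rank_dist y z.
Proof.
rewrite /rank_dist -mulrDl ler_pM2r ?invr_gt0 ?ltr0n// -natrD ler_nat.
have -> : x - z = (x - y) + (y - z) by rewrite addrA subrK.
exact: mxrank_add.
Qed.

HB.instance Definition _ := @isMetric.Build R M rank_dist
  rank_distxx rank_dist_positivity rank_dist_sym rank_dist_triangle.

Lemma rank_matrix_diagonal : entourage [set z : M * M | z.1 = z.2].
Proof.
rewrite -entourage_ballE; exists n.+1%:R^-1; first by rewrite /= invr_gt0 ltr0n.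
move=> [x y]; rewrite /= ballEmdist /= => xy; apply/eqP.
by apply: contraTT xy => /rank_dist_ge; rewrite -leNgt.
Qed.

Lemma rank_matrix_unif_continuous1 (f : M -> M) : unif_continuous f.
Proof.
move=> U entU; apply: filterS rank_matrix_diagonal => -[x y] /= ->.
exact: entourage_refl.
Qed.

Lemma rank_matrix_unif_continuous2 (f : M * M -> M) : unif_continuous f.
Proof.
move=> U entU.
exists ([set z : M * M | z.1 = z.2], [set z : M * M | z.1 = z.2]).
  by split; exact: rank_matrix_diagonal.
move=> [[x1 x2] [y1 y2]] /= [xy1 xy2]; exists ((x1, y1), (x2, y2)) => //=.
by rewrite xy1 xy2; exact: entourage_refl entU.
Qed.

Lemma rank_matrix_complete (G : set_system M) :
  ProperFilter G -> cauchy G -> exists x : M, G --> x.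
Proof.
move=> PG /(_ _ rank_matrix_diagonal) [[P Q] [/= GP GQ] PQ].
have [x [Px Qx]] := filter_ex (filterI GP GQ).
exists x => U /nbhs_singleton Ux; apply: filterS GQ => y Qy.
by have /= <- := PQ (x, y) (conj Px Qy).
Qed.

HB.instance Definition _ := @isMetricStructure.Build R F M
  (@rank_matrix_unif_continuous2 _) (@rank_matrix_unif_continuous2 _)
  (fun a => @rank_matrix_unif_continuous1 _) rank_matrix_complete.

End rank_metric.

Definition matrix_algebras (R : realType) (F : fieldType)
    (A : metricAlgType R F) : Prop :=
  exists n : nat, A = rank_matrix R F n.

Arguments matrix_algebras : clear implicits.

(* Main.v *)
Require Import Defs.
From mathcomp Require Import all_boot all_order all_algebra.
From mathcomp Require Import all_classical all_reals topology ereal.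
From HB Require Import structures.
From mathcomp Require Import mxtens.

(* M_n and M_m embed into M_(n m) by
   x |-> x (x) 1 and y |-> 1 (x) y, and both maps preserve the normalised rank;
   this is joint embedding.  Given embeddings of M_n into M_m and M_p, the two
   resulting copies of M_n inside M_(m p) are conjugate by the Skolem-Noether
   theorem, and correcting one side by this inner automorphism makes the
   amalgamation exact.  Over a finite field there are only countably many
   matrix algebras with a marked tuple, hence separability. *)

Set Implicit Arguments.
Unset Strict Implicit.
Unset Printing Implicit Defensive.

Import Order.TTheory GRing.Theory Num.Theory.

Local Open Scope ring_scope.

(** * Kronecker products: rank and ampliations *)

Lemma tens_scalar1_scalar1 (R : comPzRingType) m n :
  (1%:M : 'M[R]_m) *t (1%:M : 'M[R]_n) = 1%:M.
Proof.
apply/matrixP => i j.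
case: (mxtens_indexP i) => i0 i1; case: (mxtens_indexP j) => j0 j1.
rewrite tensmxE !mxE (can_eq (@mxtens_indexK m n)) xpair_eqE.
by rewrite -natrM mulnb.
Qed.

(** Full-rank factorisations through [col_base] and [row_base] are tensored; one-sided inverses
    tensor too, so the new factors keep full rank, with inner dimension [\rank A * \rank B]. *)
Lemma mxrank_tens (F : fieldType) m n p q
    (A : 'M[F]_(m, n)) (B : 'M[F]_(p, q)) :
  \rank (A *t B) = (\rank A * \rank B)%N.
Proof.
have [LA LAE] := row_fullP (col_base_full A).
have [LB LBE] := row_fullP (col_base_full B).
have [RA RAE] := row_freeP (row_base_free A).
have [RB RBE] := row_freeP (row_base_free B).
have fullAB : row_full (col_base A *t col_base B).
  apply/row_fullP; exists (LA *t LB).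
  by rewrite tensmx_mul LAE LBE tens_scalar1_scalar1.
have freeAB : row_free (row_base A *t row_base B).
  apply/row_freeP; exists (RA *t RB).
  by rewrite tensmx_mul RAE RBE tens_scalar1_scalar1.
rewrite -{1}(mulmx_base A) -{1}(mulmx_base B) -tensmx_mul.
by rewrite mxrankMfree // (eqP fullAB).
Qed.

Section ampliation.
Variables (F : fieldType) (n m : nat).

Definition tensmx1 (x : 'M[F]_n.+1) : 'M[F]_(n.+1 * m.+1) :=
  x *t (1%:M : 'M_m.+1).

Definition tens1mx (y : 'M[F]_m.+1) : 'M[F]_(n.+1 * m.+1) :=
  (1%:M : 'M_n.+1) *t y.

Lemma tensmx1_is_linear : linear tensmx1.
Proof. by move=> a x y; apply/matrixP => i j; rewrite !mxE mulrDl mulrA. Qed.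

Lemma tens1mx_is_linear : linear tens1mx.
Proof. by move=> a x y; apply/matrixP => i j; rewrite !mxE mulrDr mulrCA. Qed.

Lemma tensmx1_is_monoid_morphism : monoid_morphism tensmx1.
Proof.
split; first exact: tens_scalar1_scalar1.
by move=> x y; rewrite /tensmx1 [RHS]tensmx_mul mulmx1.
Qed.

Lemma tens1mx_is_monoid_morphism : monoid_morphism tens1mx.
Proof.
split; first exact: tens_scalar1_scalar1.
by move=> x y; rewrite /tens1mx [RHS]tensmx_mul mul1mx.
Qed.

HB.instance Definition _ :=
  GRing.isLinear.Build F 'M[F]_n.+1 'M[F]_(n.+1 * m.+1) _ tensmx1
    tensmx1_is_linear.
HB.instance Definition _ :=
  GRing.isMonoidMorphism.Build 'M[F]_n.+1 'M[F]_(n.+1 * m.+1) tensmx1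
    tensmx1_is_monoid_morphism.
HB.instance Definition _ :=
  GRing.isLinear.Build F 'M[F]_m.+1 'M[F]_(n.+1 * m.+1) _ tens1mx
    tens1mx_is_linear.
HB.instance Definition _ :=
  GRing.isMonoidMorphism.Build 'M[F]_m.+1 'M[F]_(n.+1 * m.+1) tens1mx
    tens1mx_is_monoid_morphism.

End ampliation.

(** * Inner automorphisms *)

Section conjugation.
Variables (F : fieldType) (n : nat) (U : 'M[F]_n.+1).

(** The proof that [U] is a unit is an argument so that the morphism structures can be attached to
    [mxconj Uunit]. *)
Definition mxconj of U \in unitmx := fun x : 'M[F]_n.+1 => U *m x *m invmx U.

Hypothesis Uunit : U \in unitmx.

Lemma mxconj_is_linear : linear (mxconj Uunit).
Proof. by move=> a x y; rewrite /mxconj mulmxDr mulmxDl -scalemxAr -scalemxAl. Qed.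

Lemma mxconj_is_monoid_morphism : monoid_morphism (mxconj Uunit).
Proof.
split=> [|x y]; rewrite /mxconj; first by rewrite mulmx1 mulmxV.
by rewrite -!mulmxE !mulmxA mulmxKV.
Qed.

HB.instance Definition _ :=
  GRing.isLinear.Build F 'M[F]_n.+1 'M[F]_n.+1 _ (mxconj Uunit)
    mxconj_is_linear.
HB.instance Definition _ :=
  GRing.isMonoidMorphism.Build 'M[F]_n.+1 'M[F]_n.+1 (mxconj Uunit)
    mxconj_is_monoid_morphism.

Lemma mxrank_mxconj x : \rank (mxconj Uunit x) = \rank x.
Proof.
rewrite /mxconj mxrankMfree ?row_free_unit ?unitmx_inv //.
by rewrite eqmxMfull ?row_full_unit.
Qed.

End conjugation.

(** * The Skolem-Noether theorem for matrix algebras *)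

Section Skolem_Noether.
Variable F : fieldType.
Local Notation e := (@delta_mx F _ _).

(** With [q = c *m w], idempotency reads [c w c w = c w]; the left inverse of [c] and the right
    inverse of [w] cancel the outer factors. *)
Lemma idempotent_mul_base m (q : 'M[F]_m) :
  q *m q = q -> row_base q *m col_base q = 1%:M.
Proof.
move=> qq; have [L LE] := row_fullP (col_base_full q).
have [R RE] := row_freeP (row_base_free q).
move: LE RE (mulmx_base q).
move: (col_base q) (row_base q) => c w LE RE cw; rewrite -cw in qq.
have := congr1 (fun z => L *m z *m R) qq.
rewrite !mulmxA LE mul1mx RE.
by rewrite -mulmxA RE mulmx1.
Qed.

(** The identity [row_base q *m col_base q = 1] is inserted between the two factors of
    [p = col_base p *m row_base p]. *)
Lemma idempotent_rank_factor m (p q : 'M[F]_m) :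
  q *m q = q -> \rank p = \rank q ->
  exists s t : 'M[F]_m, s *m t = p /\ s *m q = s.
Proof.
move=> qq pq; have := mulmx_base q; have := idempotent_mul_base qq.
(* Once the bases of [q] are generalised, the rank equality can be rewritten in their dimensions, so
   that they compose with the bases of [p]. *)
move: (col_base q) (row_base q); rewrite -pq => cq rq rcq cqE.
exists (col_base p *m rq), (cq *m row_base p); split.
- by rewrite mulmxA -(mulmxA _ rq) rcq mulmx1 mulmx_base.
- by rewrite -cqE !mulmxA -(mulmxA _ rq) rcq mulmx1.
Qed.

(* Factoring f e_00 = s * t through the idempotent g e_00, which has the same
   rank, the conjugator is \sum_i f e_i0 * s * g e_0i. *)
Lemma Skolem_Noether n N (f g : {lrmorphism 'M[F]_n.+1 -> 'M[F]_N.+1}) :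
  \rank (f (e 0 0)) = \rank (g (e 0 0)) ->
  exists2 U : 'M[F]_N.+1, U \in unitmx & forall x, f x *m U = U *m g x.
Proof.
have fM i j k l : f (e i j) * f (e k l) = f (e i l) *+ (j == k).
  by rewrite -rmorphM /= -mulmxE mul_delta_mx_cond raddfMn.
have gM i j k l : g (e i j) * g (e k l) = g (e i l) *+ (j == k).
  by rewrite -rmorphM /= -mulmxE mul_delta_mx_cond raddfMn.
have f1 : \sum_i f (e i i) = 1.
  by rewrite -raddf_sum -[RHS](rmorph1 f) -[1 in RHS]/(1%:M) mx1_sum_delta.
case/(idempotent_rank_factor (gM 0 0 0 0)) => s [t].
rewrite !mulmxE => -[st sq].
pose U := \sum_i f (e i 0) * s * g (e 0 i).
pose V := \sum_i g (e i 0) * t * f (e 0 i).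
(* Only the diagonal terms [f e_i0 * s * g e_00 * t * f e_0i] survive; by [sq] and [st] each equals
   [f e_ii]. *)
have UV : U * V = 1.
  rewrite /U mulr_suml -f1; apply: eq_bigr => i _.
  rewrite /V mulr_sumr (bigD1 i) //= big1 ?addr0 => [|j ji].
    rewrite !mulrA -(mulrA _ _ (g _)) gM eqxx mulr1n -(mulrA _ s) sq.
    by rewrite -(mulrA _ s) st !fM eqxx.
  by rewrite !mulrA -(mulrA _ _ (g _)) gM eq_sym (negPf ji) mulr0 !mul0r.
(* Both sides collapse to [f e_i0 * s * g e_0j]. *)
have fgU i j : f (e i j) * U = U * g (e i j).
  rewrite /U mulr_suml mulr_sumr (bigD1 j) //= big1 => [|k kj].
    rewrite (bigD1 i) //= [in RHS]big1 => [|k ki].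
      by rewrite !mulrA fM -!mulrA gM !eqxx.
    by rewrite -mulrA gM (negPf ki) mulr0.
  by rewrite !mulrA fM eq_sym (negPf kj) !mul0r.
exists U; first by have [] := mulmx1_unit UV.
move=> x; rewrite (matrix_sum_delta x) !linear_sum mulr_suml mulr_sumr.
apply: eq_bigr => i _; rewrite !linear_sum mulr_suml mulr_sumr.
apply: eq_bigr => j _; rewrite !linearZ_LR /= -scalerAl -scalerAr.
by congr (_ *: _); exact: fgU.
Qed.

End Skolem_Noether.

(** * Embeddings of matrix algebras, joint embedding and amalgamation *)

Section metric.
Context {R : realType} {F : fieldType}.
Local Notation malg := (metricAlgType R F).

Definition embedding_id (A : malg) : embedding A A :=
  @Embedding R F A A idfun (fun x y => erefl).

Lemma embedding_comp_isometric (A B C : malg) (g : embedding B C)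
    (f : embedding A B) x y :
  mdist ((g \o f) x) ((g \o f) y) = mdist x y.
Proof. by rewrite /= !embedding_isometric. Qed.

Definition embedding_comp (A B C : malg) (g : embedding B C)
    (f : embedding A B) : embedding A C :=
  @Embedding R F A C (g \o f) (embedding_comp_isometric g f).

Section rank_embedding.
Variables n N : nat.
Local Notation A := (rank_matrix R F n).
Local Notation B := (rank_matrix R F N).

Lemma rank_embedding_subproof (f : {lrmorphism 'M[F]_n.+1 -> 'M[F]_N.+1}) :
  (forall x, \rank (f x) * n.+1 = \rank x * N.+1)%N ->
  forall x y : A, mdist (f x : B) (f y : B) = mdist x y.
Proof.
move=> rkf x y; rewrite /mdist /= /rank_dist -raddfB.
apply/eqP; rewrite eqr_div ?pnatr_eq0 //.
by rewrite -!natrM rkf.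
Qed.

Definition rank_embedding (f : {lrmorphism 'M[F]_n.+1 -> 'M[F]_N.+1})
    (rkf : forall x, (\rank (f x) * n.+1 = \rank x * N.+1)%N) : embedding A B :=
  @Embedding R F A B f (rank_embedding_subproof rkf).

(** The distance to 0 is the normalised rank; denominators are cleared to stay in the natural
    numbers. *)
Lemma mxrank_embedding (f : embedding A B) (x : 'M[F]_n.+1) :
  (\rank (f x : 'M[F]_N.+1) * n.+1 = \rank x * N.+1)%N.
Proof.
have := embedding_isometric f x 0; rewrite raddf0.
rewrite /mdist /= /rank_dist !subr0 => /eqP.
by rewrite eqr_div ?pnatr_eq0 // -!natrM eqr_nat => /eqP.
Qed.

End rank_embedding.

Lemma mxrank_tensmx1 n m (x : 'M[F]_n.+1) :
  (\rank (tensmx1 m x) * n.+1 = \rank x * (n.+1 * m.+1))%N.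
Proof. by rewrite mxrank_tens mxrank1 -mulnA (mulnC m.+1). Qed.

Lemma mxrank_tens1mx n m (y : 'M[F]_m.+1) :
  (\rank (tens1mx n y) * m.+1 = \rank y * (n.+1 * m.+1))%N.
Proof. by rewrite mxrank_tens mxrank1 -mulnA mulnCA. Qed.

Lemma matrix_algebras_amalgamation n m p
    (phi0 : embedding (rank_matrix R F n) (rank_matrix R F m))
    (phi1 : embedding (rank_matrix R F n) (rank_matrix R F p)) :
  exists N (psi0 : embedding (rank_matrix R F m) (rank_matrix R F N))
    (psi1 : embedding (rank_matrix R F p) (rank_matrix R F N)),
    psi0 \o phi0 =1 psi1 \o phi1.
Proof.
(* Chosen so that [N.+1] is convertible to [m.+1 * p.+1], the size of the Kronecker products. *)
pose N := (p + m * p.+1)%N.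
pose psi0 : embedding (rank_matrix R F m) (rank_matrix R F N) :=
  rank_embedding (@mxrank_tensmx1 m p).
pose psi1 : embedding (rank_matrix R F p) (rank_matrix R F N) :=
  rank_embedding (@mxrank_tens1mx m p).
pose f := embedding_comp psi0 phi0; pose g := embedding_comp psi1 phi1.
(* Both composites scale ranks by the same factor [N.+1 / n.+1], which yields the rank hypothesis of
   Skolem-Noether. *)
have rk x : \rank (f x : 'M[F]_N.+1) = \rank (g x : 'M[F]_N.+1).
  by apply/eqP; rewrite -(eqn_pmul2r (ltn0Sn n)) !mxrank_embedding.
have [U Uunit fU] := @Skolem_Noether F n N f g (rk _).
have rkU x : (\rank (mxconj Uunit x) * N.+1 = \rank x * N.+1)%N.
  by rewrite mxrank_mxconj.
exists N, psi0, (embedding_comp (rank_embedding rkU) psi1) => x.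
apply: (canRL (mulmxK Uunit)); exact: fU.
Qed.

Lemma matrix_algebras_JEP : JEP (matrix_algebras R F).
Proof.
move=> _ _ [n ->] [m ->].
exists (rank_matrix R F (m + n * m.+1)); first by exists (m + n * m.+1)%N.
split; constructor.
- exact: rank_embedding (@mxrank_tensmx1 n m).
- exact: rank_embedding (@mxrank_tens1mx n m).
Qed.

Lemma matrix_algebras_NAP : NAP (matrix_algebras R F).
Proof.
move=> A B0 B1 phi0 phi1 eps [n An] [m Bm] [p Bp] eps0; subst A B0 B1.
have [N [psi0 [psi1 psiE]]] := matrix_algebras_amalgamation phi0 phi1.
exists (rank_matrix R F N), psi0, psi1; split; first by exists N.
apply: (@le_lt_trans _ _ 0%E); last by rewrite lte_fin.
by apply: ge_ereal_sup => _ [x _ <-]; rewrite psiE mdistxx.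
Qed.

(** The algebra of [b] itself serves as the common structure, with the identity on that side. *)
Lemma marked_dist_le0 (K : malg -> Prop) n (a b : marked K n)
    (phi : embedding (marked_alg a) (marked_alg b)) :
  map_tuple phi (marked_gen a) = marked_gen b -> (marked_dist a b <= 0)%E.
Proof.
move=> phiE; apply: ereal_inf_lbound.
exists (marked_alg b), phi, (embedding_id _); split; first exact: marked_in.
have -> : map_tuple (embedding_id _) (marked_gen b) = marked_gen b.
  exact/val_inj/map_id.
(* The base value 0 is not neutral for [Num.max] on [R], but [max 0 0 = 0] suffices when all terms
   vanish. *)
rewrite phiE /tuple_dist big1_idem => [//||i _].
  exact: maxxx.
exact: mdistxx.
Qed.

End metric.

(** * Finite generation and separability over a finite field *)

Section finite_field.
Context {R : realType} {F : finFieldType}.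

Lemma matrix_algebra_finitely_generated (A : metricAlgType R F) :
  matrix_algebras R F A -> finitely_generated A.
Proof.
case=> n ->; exists #|'M[F]_n.+1|, (enum_tuple 'M[F]_n.+1) => S _ _ sub x.
by apply: sub; rewrite mem_enum.
Qed.

(** Generation is not a decidable condition, so the classical [pselect] filters the tuples that
    generate. *)
Definition marked_matrix (n m : nat) (a : n.-tuple (rank_matrix R F m)) :
    option (marked (matrix_algebras R F) n) :=
  if pselect (generates a) is left ga
  then Some (Marked (ex_intro _ m erefl) ga) else None.

Lemma matrix_algebras_WPP : WPP (matrix_algebras R F).
Proof.
move=> n.
(* As [F] is finite, pairs of a size and a tuple of matrices form a countable type; the sequence
   decodes them. *)
exists (fun k => if (unpickle k : option {m & n.-tuple 'M[F]_m.+1}) is Some ma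
  then marked_matrix (tagged ma : n.-tuple (rank_matrix R F (tag ma)))
  else None).
case=> A [m Am] a ga eps eps0; subst A.
pose ma : {m & n.-tuple 'M[F]_m.+1} := Tagged (fun m => n.-tuple 'M[F]_m.+1) a.
exists (pickle ma); rewrite pickleK /= /marked_matrix.
(* The proof [ga'] may differ from [ga], so the two marked structures are compared through the
   identity embedding rather than equated. *)
case: pselect => // ga'; eexists; split; first by [].
apply: (@le_lt_trans _ _ 0%E); last by rewrite lte_fin.
by apply: (marked_dist_le0 (phi := embedding_id _)); exact/val_inj/map_id.
Qed.

End finite_field.

Theorem mainTheorem1 (R : realType) (F : finFieldType) :
  metric_fraisse_class (matrix_algebras R F).
Proof.
split.
- exact: matrix_algebra_finitely_generated.
- exact: matrix_algebras_JEP.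
- exact: matrix_algebras_NAP.
- exact: matrix_algebras_WPP.
Qed.
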